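(* Let $F$ be a field of characteristic different from $2$. Let $T$ and $C$ both denote the space of alternating $4\times4$ matrices over $F$, viewed as $\mathfrak{sl}(4)$-modules via $a\cdot s=as+sa'$ for $s\in T$ and $a\cdot t=-a't-ta$ for $t\in C$ ($a\in\mathfrak{sl}(4)$). Then the map $h:T\to C$ given by $$s=\begin{pmatrix}0&a&b&c\\ -a&0&d&e\\ -b&-d&0&f\\ -c&-e&-f&0\end{pmatrix}\mapsto s^*=\begin{pmatrix}0&f&-e&d\\ -f&0&c&-b\\ e&-c&0&a\\ -d&b&-a&0\end{pmatrix}$$ is an isomorphism of $\mathfrak{sl}(4)$-modules. The composite map $T\to C\to T^*$ given by $s\mapsto\phi_{s^*}$, where $\phi_t(u)=\mathrm{tr}(tu)$ for $t\in C$, $u\in T$, is an isomorphism of $\mathfrak{sl}(4)$-modules. The corresponding non-degenerate $\mathfrak{sl}(4)$-invariant bilinear form $g:T\times T\to F$, namely $g(s,t)=\mathrm{tr}(s^*t)$, is symmetric. Consequently, $\mathfrak{sl}(4)\cong\mathfrak{so}(6)$ as Lie algebras provided every element of $F$ is a square.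
   Context: $a'$ denotes the transpose of $a$. A matrix $A$ is alternating if $A_{ij}=-A_{ji}$ and $A_{ii}=0$ for all $i,j$. $\mathfrak{sl}(4)$ is the Lie algebra of traceless $4\times4$ matrices over $F$ with bracket $[x,y]=xy-yx$, and $\mathfrak{so}(6)$ is the Lie algebra of skew-symmetric $6\times 6$ matrices over $F$. The dual $W^*$ of an $L$-module $W$ is an $L$-module via $(x\cdot\alpha)(w)=\alpha(-x\cdot w)$. A bilinear form $g$ on $W$ is $L$-invariant if $g(x\cdot u,v)+g(u,x\cdot v)=0$ for all $x\in L$, $u,v\in W$. *)

(* Defs.v *)
From HB Require Import structures.
From mathcomp Require Import all_boot all_algebra ring.

Set Implicit Arguments.
Unset Strict Implicit.
Unset Printing Implicit Defensive.

Import GRing.Theory.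
Local Open Scope ring_scope.

HB.mixin Record Lmodule_isLieAlgebra (F : fieldType) L of GRing.Lmodule F L := {
  lie_bracket : L -> L -> L;
  lie_bracket_bilinear : bilinear_for *:%R *:%R lie_bracket;
  lie_bracketxx : forall x, lie_bracket x x = 0;
  lie_jacobi : forall x y z,
    lie_bracket x (lie_bracket y z) + lie_bracket y (lie_bracket z x)
      + lie_bracket z (lie_bracket x y) = 0
}.

#[short(type="lieAlgType")]
HB.structure Definition LieAlgebra (F : fieldType) :=
  {L of Lmodule_isLieAlgebra F L & GRing.Lmodule F L}.

Notation "\[ x , y ]" := (lie_bracket x y)
  (at level 0, x, y at level 99, format "\[ x ,  y ]") : ring_scope.

(* Finite-dimensional modules, so that the dual is ['Hom(V, F^o)]. *)
HB.mixin Record Vector_isLieModule (F : fieldType) (L : lieAlgType F) V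
    of Vector F V := {
  lie_act : L -> V -> V;
  lie_act_bilinear : bilinear_for *:%R *:%R lie_act;
  lie_act_bracket : forall x y v,
    lie_act \[ x, y ] v = lie_act x (lie_act y v) - lie_act y (lie_act x v)
}.

#[short(type="lieModType")]
HB.structure Definition LieModule (F : fieldType) (L : lieAlgType F) :=
  {V of Vector_isLieModule F L V & Vector F V}.

Notation "x \act v" := (lie_act x v)
  (at level 40, v at next level, format "x  \act  v") : ring_scope.

Definition lie_isomorphic (F : fieldType) (L1 L2 : lieAlgType F) : Prop :=
  exists f : L1 -> L2,
    [/\ linear f, bijective f & {morph f : x y / \[ x, y ]}].

Definition lie_module_isomorphism (F : fieldType) (L : lieAlgType F)
    (V W : lieModType L) (f : V -> W) : Prop :=
  [/\ linear f, bijective f & forall (x : L) v, f (x \act v) = x \act f v].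

Definition lie_invariant (F : fieldType) (L : lieAlgType F) (V : lieModType L)
    (g : V -> V -> F) : Prop :=
  forall (x : L) u v, g (x \act u) v + g u (x \act v) = 0.

Definition nondegenerate_form (F : fieldType) (V : vectType F)
    (g : V -> V -> F) : Prop :=
  (forall u, (forall v, g u v = 0) -> u = 0) /\
  (forall v, (forall u, g u v = 0) -> v = 0).

Definition symmetric_bilinear (F : fieldType) (V : vectType F)
    (g : V -> V -> F) : Prop :=
  forall u v, g u v = g v u.

HB.instance Definition _ (F : fieldType) (L : lieAlgType F)
    (V : lieModType L) (x : L) :=
  GRing.isLinear.Build F V V *:%R (lie_act x) (lie_act_bilinear.2 x).

Section Dual.
Variables (F : fieldType) (L : lieAlgType F) (V : lieModType L).

Definition dual_act_fun (x : L) (alpha : 'Hom(V, F^o)) (w : V) : F^o :=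
  alpha (- (x \act w)).

Lemma dual_act_fun_linear x alpha : linear (dual_act_fun x alpha).
Proof.
by move=> a u v; rewrite /dual_act_fun linearP opprD -scalerN linearP.
Qed.

HB.instance Definition _ x alpha :=
  GRing.isLinear.Build F V F^o *:%R (dual_act_fun x alpha)
    (dual_act_fun_linear x alpha).

Definition dual_act (x : L) (alpha : 'Hom(V, F^o)) : 'Hom(V, F^o) :=
  linfun (dual_act_fun x alpha).

Lemma dual_actE x alpha w : dual_act x alpha w = alpha (- (x \act w)).
Proof. by rewrite lfunE. Qed.

Lemma dual_act_bilinear : bilinear_for *:%R *:%R dual_act.
Proof.
split=> [alpha a x y|x a alpha beta]; apply/lfunP=> w.
  rewrite dual_actE [RHS]lfunE /= [X in _ = X + _]lfunE /= !dual_actE.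
  have /= -> := (@lie_act_bilinear F L V).1 w a x y.
  by rewrite opprD -scalerN linearP.
rewrite dual_actE lfunE /= [X in X + _]lfunE /= [RHS]lfunE /= [X in _ = X + _]lfunE /=.
by rewrite !dual_actE.
Qed.

Lemma dual_act_bracket x y alpha :
  dual_act \[ x, y ] alpha
  = dual_act x (dual_act y alpha) - dual_act y (dual_act x alpha).
Proof.
apply/lfunP=> w; rewrite dual_actE [RHS]lfunE /= [X in _ + X]lfunE /=.
rewrite !dual_actE lie_act_bracket opprB.
rewrite (raddfN (lie_act x)) (raddfN (lie_act y)) !opprK.
exact: linearB.
Qed.

Definition lie_dual : Type := 'Hom(V, F^o).
HB.instance Definition _ := Vector.copy lie_dual 'Hom(V, F^o).
HB.instance Definition _ :=
  Vector_isLieModule.Build F L lie_dual dual_act_bilinear dual_act_bracket.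

End Dual.

Section MatrixSpaces.
Variables (F : fieldType) (n : nat).
Implicit Types a : 'M[F]_n.

Definition commmx a b : 'M[F]_n := a *m b - b *m a.

Definition skew_part a : 'M[F]_n := a + a^T.
Definition diag_row a : 'rV[F]_n := \row_i a i i.

Lemma skew_part_linear : linear skew_part.
Proof.
by move=> k a b; rewrite /skew_part linearP /= scalerDr addrACA.
Qed.
HB.instance Definition _ :=
  GRing.isLinear.Build F 'M[F]_n 'M[F]_n *:%R skew_part skew_part_linear.

Lemma diag_row_linear : linear diag_row.
Proof. by move=> k a b; apply/rowP=> i; rewrite !mxE. Qed.
HB.instance Definition _ :=
  GRing.isLinear.Build F 'M[F]_n 'rV[F]_n *:%R diag_row diag_row_linear.

Definition sl_space : {vspace 'M[F]_n} :=
  lker (linfun (fun a => \tr a : F^o)).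
Definition so_space : {vspace 'M[F]_n} := lker (linfun skew_part).
Definition alt_space : {vspace 'M[F]_n} :=
  (so_space :&: lker (linfun diag_row))%VS.

Lemma mem_sl a : (a \in sl_space) = (\tr a == 0).
Proof. by rewrite memv_ker lfunE. Qed.

Lemma mem_so a : (a \in so_space) = (a^T == - a).
Proof. by rewrite memv_ker lfunE /= /skew_part addrC addr_eq0. Qed.

Lemma mem_altP a :
  reflect ((forall i j, a i j = - a j i) /\ (forall i, a i i = 0))
          (a \in alt_space).
Proof.
rewrite memv_cap mem_so memv_ker lfunE /=.
apply: (iffP andP) => [[/eqP aT /eqP ad]|[aT ad]].
  split=> [i j|i].
    by have /matrixP/(_ j i) := aT; rewrite !mxE.
  by have /rowP/(_ i) := ad; rewrite !mxE.
split; apply/eqP; first by apply/matrixP=> i j; rewrite !mxE.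
by apply/rowP=> i; rewrite !mxE.
Qed.


Lemma commmx_bilinear : bilinear_for *:%R *:%R commmx.
Proof.
split=> [b k a a'|a k b b'] /=; rewrite /commmx.
  rewrite mulmxDl mulmxDr -scalemxAl -scalemxAr scalerBr.
  by rewrite opprD addrACA.
rewrite mulmxDl mulmxDr -scalemxAl -scalemxAr scalerBr.
by rewrite opprD addrACA.
Qed.

Lemma commmxx a : commmx a a = 0.
Proof. exact: subrr. Qed.

Lemma commmx_jacobi a b c :
  commmx a (commmx b c) + commmx b (commmx c a) + commmx c (commmx a b) = 0.
Proof.
rewrite /commmx !mulmxBl !mulmxBr !mulmxA.
move: (a *m b *m c) (a *m c *m b) (b *m c *m a) => p q r.
move: (c *m b *m a) (b *m a *m c) (c *m a *m b) => t u v.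
by apply/matrixP=> i j; rewrite !mxE; ring.
Qed.

Lemma commmx_sl a b : commmx a b \in sl_space.
Proof. by rewrite mem_sl linearB /= mxtrace_mulC subrr. Qed.

Lemma commmx_so a b :
  a \in so_space -> b \in so_space -> commmx a b \in so_space.
Proof.
rewrite !mem_so => /eqP aT /eqP bT; rewrite /commmx linearB /= !trmx_mul aT bT.
by rewrite !(mulNmx, mulmxN) !opprK opprB.
Qed.

Definition alt_act a s : 'M[F]_n := a *m s + s *m a^T.
Definition alt_coact a t : 'M[F]_n := - (a^T *m t) - t *m a.

Lemma alt_act_alt a s : s \in alt_space -> alt_act a s \in alt_space.
Proof.
move=> /mem_altP[sT sd]; apply/mem_altP; split=> [i j|i]; rewrite !mxE.
  rewrite opprD addrC -!sumrN; congr (_ + _); apply: eq_bigr => k _.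
    by rewrite !mxE (sT i k); ring.
  by rewrite !mxE (sT k j); ring.
rewrite -big_split big1 //= => k _.
by rewrite !mxE (sT k i); ring.
Qed.

Lemma alt_coactE a t : alt_coact a t = alt_act (- a^T) t.
Proof. by rewrite /alt_act linearN /= trmxK mulNmx mulmxN. Qed.

Lemma alt_coact_alt a t : t \in alt_space -> alt_coact a t \in alt_space.
Proof. by rewrite alt_coactE; apply: alt_act_alt. Qed.

Lemma alt_act_bilinear : bilinear_for *:%R *:%R alt_act.
Proof.
split=> [s k a a'|a k s s'] /=; rewrite /alt_act.
  rewrite linearP /= mulmxDl mulmxDr -scalemxAl -scalemxAr scalerDr.
  by rewrite addrACA.
by rewrite mulmxDl mulmxDr -scalemxAl -scalemxAr scalerDr addrACA.
Qed.

Lemma alt_act_comm a b s :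
  alt_act (commmx a b) s = alt_act a (alt_act b s) - alt_act b (alt_act a s).
Proof.
rewrite /alt_act /commmx linearB /= !trmx_mul !(mulmxDl, mulmxDr).
rewrite !(mulNmx, mulmxN) !mulmxA.
move: (a *m b *m s) (b *m a *m s) (s *m a^T *m b^T) (s *m b^T *m a^T).
move: (a *m s *m b^T) (b *m s *m a^T) => p q r t u v.
by apply/matrixP=> i j; rewrite !mxE; ring.
Qed.

Definition sl : Type := subvs_of sl_space.
HB.instance Definition _ := Vector.copy sl (subvs_of sl_space).

Definition so : Type := subvs_of so_space.
HB.instance Definition _ := Vector.copy so (subvs_of so_space).

Definition sl_bracket (x y : sl) : sl := Subvs (commmx_sl (vsval x) (vsval y)).

Definition so_bracket (x y : so) : so :=
  Subvs (commmx_so (valP x) (valP y)).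

Lemma sl_bracket_bilinear : bilinear_for *:%R *:%R sl_bracket.
Proof.
split=> [y k x x'|x k y y']; apply: val_inj.
  exact: (commmx_bilinear.1 _ _ _ _).
exact: (commmx_bilinear.2 _ _ _ _).
Qed.

Lemma sl_bracketxx x : sl_bracket x x = 0.
Proof. by apply: val_inj; exact: commmxx. Qed.

Lemma sl_jacobi x y z :
  sl_bracket x (sl_bracket y z) + sl_bracket y (sl_bracket z x)
    + sl_bracket z (sl_bracket x y) = 0.
Proof. by apply: val_inj; exact: commmx_jacobi. Qed.

HB.instance Definition _ := Lmodule_isLieAlgebra.Build F sl
  sl_bracket_bilinear sl_bracketxx sl_jacobi.

Lemma so_bracket_bilinear : bilinear_for *:%R *:%R so_bracket.
Proof.
split=> [y k x x'|x k y y']; apply: val_inj.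
  exact: (commmx_bilinear.1 _ _ _ _).
exact: (commmx_bilinear.2 _ _ _ _).
Qed.

Lemma so_bracketxx x : so_bracket x x = 0.
Proof. by apply: val_inj; exact: commmxx. Qed.

Lemma so_jacobi x y z :
  so_bracket x (so_bracket y z) + so_bracket y (so_bracket z x)
    + so_bracket z (so_bracket x y) = 0.
Proof. by apply: val_inj; exact: commmx_jacobi. Qed.

HB.instance Definition _ := Lmodule_isLieAlgebra.Build F so
  so_bracket_bilinear so_bracketxx so_jacobi.

(* Two copies of the alternating matrices, carrying different actions. *)
Definition altT : Type := subvs_of alt_space.
HB.instance Definition _ := Vector.copy altT (subvs_of alt_space).

Definition altC : Type := subvs_of alt_space.
HB.instance Definition _ := Vector.copy altC (subvs_of alt_space).

Definition altT_act (x : sl) (s : altT) : altT :=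
  Subvs (alt_act_alt (vsval x) (valP s)).

Definition altC_act (x : sl) (t : altC) : altC :=
  Subvs (alt_coact_alt (vsval x) (valP t)).

Lemma altT_act_bilinear : bilinear_for *:%R *:%R altT_act.
Proof.
split=> [s k x x'|x k s s']; apply: val_inj.
  exact: (alt_act_bilinear.1 _ _ _ _).
exact: (alt_act_bilinear.2 _ _ _ _).
Qed.

Lemma altT_act_bracket x y s :
  altT_act \[ x, y ] s
  = altT_act x (altT_act y s) - altT_act y (altT_act x s).
Proof. by apply: val_inj; exact: alt_act_comm. Qed.

HB.instance Definition _ := Vector_isLieModule.Build F sl altT
  altT_act_bilinear altT_act_bracket.

Lemma alt_coact_bilinear : bilinear_for *:%R *:%R alt_coact.
Proof.
split=> [t k a a'|a k t t'] /=; rewrite !alt_coactE.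
  have <- := alt_act_bilinear.1 t k (- a^T) (- a'^T).
  by rewrite linearP /= opprD scalerN.
exact: (alt_act_bilinear.2 _ _ _ _).
Qed.

Lemma alt_coact_comm a b t :
  alt_coact (commmx a b) t
  = alt_coact a (alt_coact b t) - alt_coact b (alt_coact a t).
Proof.
rewrite !alt_coactE -alt_act_comm; congr alt_act.
rewrite /commmx linearB /= !trmx_mul !(mulNmx, mulmxN) !opprK opprB.
by [].
Qed.

Lemma altC_act_bilinear : bilinear_for *:%R *:%R altC_act.
Proof.
split=> [t k x x'|x k t t']; apply: val_inj.
  exact: (alt_coact_bilinear.1 _ _ _ _).
exact: (alt_coact_bilinear.2 _ _ _ _).
Qed.

Lemma altC_act_bracket x y t :
  altC_act \[ x, y ] t
  = altC_act x (altC_act y t) - altC_act y (altC_act x t).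
Proof. by apply: val_inj; exact: alt_coact_comm. Qed.

HB.instance Definition _ := Vector_isLieModule.Build F sl altC
  altC_act_bilinear altC_act_bracket.

End MatrixSpaces.

Section StarMap.
Variable F : fieldType.

Definition mx_of_rows n (r : seq (seq F)) : 'M[F]_n :=
  \matrix_(i, j) nth 0 (nth [::] r i) j.

(* The matrix s^* attached to an alternating s with strictly upper entries
   (a, b, c, d, e, f) read row by row. *)
Definition star_mx (s : 'M[F]_4) : 'M[F]_4 :=
  let a := s 0 1 in let b := s 0 2 in let c := s 0 3 in
  let d := s 1 2 in let e := s 1 3 in let f := s 2 3 in
  mx_of_rows 4 [:: [::   0;   f; - e;   d];
                   [:: - f;   0;   c; - b];
                   [::   e; - c;   0;   a];
                   [:: - d;   b; - a;   0]].

Lemma star_mx_alt s : star_mx s \in alt_space F 4.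
Proof.
apply/mem_altP; split=> [[[|[|[|[|//]]]] ?] [[|[|[|[|//]]]] ?]|[[|[|[|[|//]]]] ?]];
  by rewrite !mxE /= ?opprK ?oppr0.
Qed.

Definition star (s : altT F 4) : altC F 4 := Subvs (star_mx_alt (vsval s)).

Lemma star_mx_rows a b c d e f :
  star_mx (mx_of_rows 4 [:: [::   0;   a;   b; c];
                            [:: - a;   0;   d; e];
                            [:: - b; - d;   0; f];
                            [:: - c; - e; - f; 0]])
  = mx_of_rows 4 [:: [::   0;   f; - e;   d];
                     [:: - f;   0;   c; - b];
                     [::   e; - c;   0;   a];
                     [:: - d;   b; - a;   0]].
Proof. by rewrite /star_mx !mxE. Qed.

Definition trace_fun n (t : altC F n) (u : altT F n) : F^o :=
  \tr (vsval t *m vsval u).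

Lemma trace_fun_linear n (t : altC F n) : linear (trace_fun t).
Proof.
move=> k u v; rewrite /trace_fun.
by rewrite -[LHS]/(\tr (vsval t *m (k *: vsval u + vsval v))) !linearP.
Qed.

HB.instance Definition _ n (t : altC F n) :=
  GRing.isLinear.Build F (altT F n) F^o *:%R (trace_fun t) (trace_fun_linear t).

Definition trace_pairing n (t : altC F n) : lie_dual (altT F n) :=
  linfun (trace_fun t).

Lemma trace_pairingE n (t : altC F n) (u : altT F n) :
  (trace_pairing t : 'Hom(altT F n, F^o)) u = \tr (vsval t *m vsval u).
Proof. by rewrite lfunE. Qed.

Definition star_form (s t : altT F 4) : F := \tr (vsval (star s) *m vsval t).

End StarMap.

(* Main.v *)
Require Import Defs.
From HB Require Import structures.
From mathcomp Require Import all_boot all_algebra.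
From mathcomp Require Import ring.

(* The trace form pairs the two actions invariantly, so all module statements
   reduce to [star] intertwining them, an entrywise identity using tr a = 0.
   The form g is, up to a factor -2, the polarization of the Pfaffian
   af - be + cd; with a square root of -1 it is a sum of six squares. In an
   orthogonal frame sl(4) therefore acts by skew-symmetric 6x6 matrices. This
   action is faithful and dim sl(4) = 15 >= dim so(6), so the representation is
   an isomorphism. *)

Set Implicit Arguments.
Unset Strict Implicit.
Unset Printing Implicit Defensive.

Import GRing.Theory.
Local Open Scope ring_scope.

(** * Preliminaries on linear maps, characteristic and traces *)

Lemma linear_inj_bij (F : fieldType) (V W : vectType F) (f : {linear V -> W}) :
  injective f -> (\dim {:W} <= \dim {:V})%N -> bijective f.
Proof.
move=> f_inj leWV; pose g := linfun f.
have gE v : g v = f v by rewrite lfunE.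
have ker_g : lker g == 0%VS.
  by apply/lker0P=> u v; rewrite !gE; apply: f_inj.
have img_g : limg g = fullv.
  apply/eqP; rewrite eqEdim subvf /=.
  by rewrite limg_dim_eq // (eqP ker_g) capv0.
exists (g^-1)%VF => w; first by rewrite -gE lker0_lfunK.
by rewrite -gE limg_lfunVK // img_g memvf.
Qed.

Lemma eq_opp0 (R : idomainType) (x : R) : 2%N \notin [pchar R] -> x = - x -> x = 0.
Proof.
move=> hR /eqP; rewrite -addr_eq0 -mulr2n -mulr_natr mulf_eq0.
by case/orP=> /eqP // h2; case/negP: hR; rewrite inE /= h2.
Qed.

Lemma mxtrace_mul_delta (R : comNzRingType) n (A : 'M[R]_n) i j :
  \tr (A *m delta_mx i j) = A j i.
Proof.
rewrite mxtrace_mulC /mxtrace (bigD1 i) //= big1 ?addr0 => [|k /negPf ki].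
  rewrite mxE (bigD1 j) //= big1 => [|k /negPf kj]; rewrite !mxE ?kj ?andbF ?mul0r //.
  by rewrite !eqxx mul1r addr0.
by rewrite mxE big1 // => l _; rewrite !mxE ki mul0r.
Qed.

(** * The two actions of square matrices on alternating ones *)

Section AlternatingMatrices.
Variables (F : fieldType) (n : nat).
Implicit Types (a s t u : 'M[F]_n) (i j k l : 'I_n).

Lemma delta_skew_alt i j : (delta_mx i j - delta_mx j i : 'M[F]_n) \in alt_space F n.
Proof.
apply/mem_altP; split=> [k l|k]; last by rewrite !mxE andbC subrr.
by rewrite !mxE opprB ![(l == _) && _]andbC.
Qed.

(** Cyclicity of the trace cancels the four terms in pairs: under the trace pairing, [alt_coact] is
    contragredient to [alt_act]. *)
Lemma mxtrace_coact a t u :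
  \tr (alt_coact a t *m u) + \tr (t *m alt_act a u) = 0.
Proof.
rewrite /alt_coact /alt_act mulmxBl mulmxDr mulNmx linearB linearN linearD /=.
rewrite -(mulmxA a^T) [\tr (a^T *m _)]mxtrace_mulC !mulmxA.
by rewrite [X in _ + X]addrC -opprD addNr.
Qed.

(** Pairing with E_ji - E_ij yields t_ij - t_ji, which is 2 t_ij for alternating [t]. *)
Lemma alt_trace_nondeg t : 2%N \notin [pchar F] -> t \in alt_space F n ->
  (forall u, u \in alt_space F n -> \tr (t *m u) = 0) -> t = 0.
Proof.
move=> hF /mem_altP[tT _] t0; apply/matrixP=> i j; rewrite mxE.
have := t0 _ (delta_skew_alt j i); rewrite mulmxBr linearB /= !mxtrace_mul_delta.
by move/subr0_eq => tji; apply: eq_opp0 => //; rewrite {1}tji.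
Qed.

Lemma alt_act_delta a k l i j :
  alt_act a (delta_mx k l - delta_mx l k) i j =
  a i k *+ (j == l) - a i l *+ (j == k) + (a j l *+ (i == k) - a j k *+ (i == l)).
Proof.
have row_delta b (p q r c : 'I_n) : (b *m delta_mx p q) r c = b r p *+ (c == q) :> F.
  rewrite mxE (bigD1 p) //= big1 ?addr0 => [|m /negPf mp].
    by rewrite mxE eqxx mulr_natr.
  by rewrite mxE mp mulr0.
have col_delta b (p q r c : 'I_n) : (delta_mx p q *m b^T) r c = b c q *+ (r == p) :> F.
  by rewrite -[delta_mx _ _]trmxK -trmx_mul mxE trmx_delta row_delta.
rewrite /alt_act mulmxBr mulmxBl mxE [X in X + _]mxE [X in _ + X]mxE.
by rewrite ![(- (_ : 'M_n)) _ _]mxE !row_delta !col_delta.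
Qed.

(** The (p, q) entry of the action on E_pq - E_qp gives a_pp + a_qq = 0, so three distinct indices
    yield a_ii = -a_ll = a_mm = -a_ii. *)
Lemma alt_act_faithful a : 2%N \notin [pchar F] -> (2 < n)%N ->
  (forall s, s \in alt_space F n -> alt_act a s = 0) -> a = 0.
Proof.
move=> hF n3 a0; apply/matrixP=> i k; rewrite mxE.
have third p q : exists m : 'I_n, (m != p) && (m != q).
  have : (0 < #|~: [set p; q]|)%N.
    rewrite cardsCs setCK card_ord subn_gt0 (leq_ltn_trans _ n3) //.
    by rewrite cards2; case: (_ != _).
  by case/card_gt0P=> m; rewrite !inE negb_or => mpq; exists m.
have a0E p q i' j' : _ = 0 := etrans (esym (alt_act_delta a p q i' j'))
  (etrans (congr1 (fun m : 'M_n => m i' j') (a0 _ (delta_skew_alt p q))) (mxE _ _ _ _)).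
have diag p q : p != q -> a p p = - a q q.
  move=> pq; have := a0E p q p q; rewrite !eqxx (negPf pq) eq_sym (negPf pq) /=.
  by rewrite !mulr0n !mulr1n !subr0 => /eqP; rewrite addr_eq0 => /eqP.
have [l /andP[li lk]] := third i k; have [<-{k lk}|ik] := eqVneq i k.
  have [m /andP[mi ml]] := third i l.
  have := diag i l; rewrite eq_sym li (diag l m) 1?eq_sym // (diag m i) // => /(_ isT).
  by rewrite opprK; apply: eq_opp0.
(* As i, k, l are distinct, entry (i, l) of the action on E_kl - E_lk is just a_ik. *)
have := a0E k l i l.
by rewrite eqxx (negPf lk) (negPf ik) eq_sym (negPf li) !mulr0n !subr0 !addr0.
Qed.

End AlternatingMatrices.

(** * Dimension bounds for sl(n) and so(n) *)

Section Dimensions.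
Variables (F : fieldType) (n : nat).

(** Rank-nullity for the trace, whose image lies in a line. *)
Lemma dim_sl_ge : (n ^ 2 - 1 <= \dim (sl_space F n))%N.
Proof.
rewrite leq_subLR.
have := limg_ker_dim (linfun (fun a : 'M[F]_n => \tr a : F^o)) fullv.
rewrite capfv dimvf. rewrite /dim /= -mulnn => <-.
by rewrite addnC leq_add2r (leq_trans (dimvS (subvf _))) // dimvf.
Qed.

(** The matrices E_pq - E_qp with q < p span, since the diagonal vanishes in characteristic other
    than 2. *)
Lemma dim_so_le : 2%N \notin [pchar F] -> (\dim (so_space F n) <= 'C(n, 2))%N.
Proof.
move=> hF.
pose e (p : 'I_n * 'I_n) : 'M[F]_n := delta_mx p.1 p.2 - delta_mx p.2 p.1.
pose D := [pred p : 'I_n * 'I_n | (p.2 < p.1)%N].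
have sub : (so_space F n <= <<[seq e p | p in D]>>)%VS.
  apply/subvP=> a; rewrite mem_so => /eqP aT.
  have {}aT i j : a i j = - a j i by have /matrixP/(_ j i) := aT; rewrite !mxE.
  have -> : a = \sum_(p in D) a p.1 p.2 *: e p.
    apply/matrixP=> i j; rewrite summxE.
    (* Only p = (i, j) and p = (j, i) can contribute to entry (i, j), and at most one of them lies
       in [D]. *)
    have eE p : (a p.1 p.2 *: e p) i j =
        a i j *+ (p == (i, j)) - a j i *+ (p == (j, i)).
      case: p => p q; rewrite !mxE /= mulrBr !mulr_natr !xpair_eqE.
      rewrite ![_ == p]eq_sym ![_ == q]eq_sym andbC.
      by congr (_ - _); [case: andP => // -[/eqP-> /eqP->]|
        rewrite andbC; case: andP => // -[/eqP-> /eqP->]].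
    rewrite (eq_bigr _ (fun p _ => eE p)) sumrB.
    have sumE p c : \sum_(q in D) c *+ (q == p) = c *+ (p \in D) :> F.
      have [pD|pD] := boolP (p \in D).
        rewrite (bigD1 p) //= eqxx big1 ?addr0 // => q /andP[_ /negPf ->].
        by rewrite mulr0n.
      by rewrite big1 // => q qD; case: eqP pD => // <-; rewrite qD.
    rewrite !sumE !inE /= (aT j i) mulNrn opprK.
    case: ltngtP => [_|_|/val_inj->]; rewrite ?mulr0n ?add0r ?addr0 //=.
    by rewrite (eq_opp0 hF (aT i i)).
  apply: rpred_sum => p pD; rewrite rpredZ // memv_span //; exact: image_f.
apply: leq_trans (dimvS sub) (leq_trans (dim_span _) _).
(* Row i contains i pairs of [D]; summing over the rows gives C(n, 2). *)
rewrite size_image -triangular_sum big_mkord -sum1_card.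
rewrite (eq_bigl _ _ (fun p => erefl)) -(pair_big_dep xpredT (fun i j : 'I_n => (j < i)%N) (fun _ _ => 1%N)) /=.
apply: leq_sum => i _.
by rewrite -(big_ord_widen _ (fun=> 1%N) (ltnW (ltn_ord i))) sum1_card card_ord.
Qed.

End Dimensions.

(** * The star map as a bijection intertwining the two actions *)

Section Star.
Variable F : fieldType.
Implicit Types (s t : altT F 4) (x : sl F 4).

Lemma alt_actE n (a s : 'M[F]_n) i j :
  alt_act a s i j = \sum_k (a i k * s k j + s i k * a j k).
Proof.
rewrite mxE 2!mxE -big_split; apply: eq_bigr => k _.
by rewrite [a^T _ _]mxE.
Qed.

Lemma sum_ord4 (f : 'I_4 -> F) : \sum_i f i = f 0 + f 1 + f 2 + f 3.
Proof.
rewrite !big_ord_recr big_ord0 /= add0r.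
by congr (f _ + f _ + f _ + f _); apply: val_inj.
Qed.

Lemma alt4_eqP (s t : 'M[F]_4) : s \in alt_space F 4 -> t \in alt_space F 4 ->
  [/\ s 0 1 = t 0 1, s 0 2 = t 0 2 & s 0 3 = t 0 3] ->
  [/\ s 1 2 = t 1 2, s 1 3 = t 1 3 & s 2 3 = t 2 3] -> s = t.
Proof.
move=> /mem_altP[sT sd] /mem_altP[tT td] [e01 e02 e03] [e12 e13 e23].
have e (i j : 'I_4) : (i < j)%N -> s i j = t i j.
  move: i j => [[|[|[|[|//]]]] ?] [[|[|[|[|//]]]] ?] //= _;
    [move: e01 | move: e02 | move: e03 | move: e12 | move: e13 | move: e23];
    by congr (s _ _ = t _ _); apply: val_inj.
apply/matrixP=> i j; case: (ltngtP i j) => [/e //|ji|/val_inj ->].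
  by rewrite sT tT e.
by rewrite sd td.
Qed.

(** Packed as a product to serve as one multirule for [rewrite], bringing every entry to the
    strictly upper ones. *)
Lemma alt4E (s : 'M[F]_4) : s \in alt_space F 4 ->
  (((s 0 0 = 0) * (s 1 1 = 0) * (s 2 2 = 0) * (s 3 3 = 0))
  * ((s 1 0 = - s 0 1) * (s 2 0 = - s 0 2) * (s 3 0 = - s 0 3))
  * ((s 2 1 = - s 1 2) * (s 3 1 = - s 1 3) * (s 3 2 = - s 2 3)))%type.
Proof. by move=> /mem_altP[sT sd]; rewrite !sd -!sT. Qed.

Lemma star_mxE (s : 'M[F]_4) :
  ((star_mx s 0 1 = s 2 3) * (star_mx s 0 2 = - s 1 3) * (star_mx s 0 3 = s 1 2)
  * (star_mx s 1 2 = s 0 3) * (star_mx s 1 3 = - s 0 2)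
  * (star_mx s 2 3 = s 0 1))%type.
Proof. by rewrite !mxE. Qed.

Lemma star_linear : linear (@star F).
Proof.
move=> k s t; apply: val_inj => /=; apply/matrixP.
by move=> [[|[|[|[|//]]]] ?] [[|[|[|[|//]]]] ?]; rewrite !mxE /=; ring.
Qed.
HB.instance Definition _ :=
  GRing.isLinear.Build F (altT F 4) (altC F 4) *:%R (@star F) star_linear.

Lemma star_mxK : {in alt_space F 4, involutive (@star_mx F)}.
Proof.
move=> s s_alt; apply: alt4_eqP; rewrite ?star_mx_alt //.
  by split; rewrite !star_mxE ?opprK.
by split; rewrite !star_mxE ?opprK.
Qed.

Lemma star_bij : bijective (@star F).
Proof.
exists (fun t : altC F 4 => Subvs (star_mx_alt (vsval t)) : altT F 4) => s;
  by apply: val_inj; rewrite /= star_mxK // (valP s).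
Qed.

(** The star is the duality between the exterior squares of F^4 and of its dual, twisted by the
    determinant: for general [a] the two sides differ by tr(a) times [star_mx s]. *)
Lemma star_mx_act (a s : 'M[F]_4) : \tr a = 0 -> s \in alt_space F 4 ->
  star_mx (alt_act a s) = alt_coact a (star_mx s).
Proof.
move=> tr0 s_alt.
(* Eliminating a_33 turns the six upper entries into plain ring identities. *)
have {}tr0 : a 3 3 = - (a 0 0 + a 1 1 + a 2 2).
  by apply/eqP; rewrite -addr_eq0 addrC -tr0 /mxtrace sum_ord4.
apply: alt4_eqP; rewrite ?star_mx_alt ?alt_coact_alt ?star_mx_alt //.
  split; rewrite star_mxE alt_coactE !alt_actE !sum_ord4 !(alt4E (star_mx_alt s))
    !star_mxE !(alt4E s_alt) ![(- a^T) _ _]mxE ![a^T _ _]mxE tr0; ring.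
split; rewrite star_mxE alt_coactE !alt_actE !sum_ord4 !(alt4E (star_mx_alt s))
    !star_mxE !(alt4E s_alt) ![(- a^T) _ _]mxE ![a^T _ _]mxE tr0; ring.
Qed.

End Star.

(** * The form g and the induced map to the dual *)

Section Form.
Variable F : fieldType.
Implicit Types (s t : altT F 4) (x : sl F 4).

Lemma star_act x s : star (x \act s) = x \act star s.
Proof.
apply: val_inj; apply: star_mx_act (valP s).
by apply/eqP; rewrite -mem_sl (valP x).
Qed.

(** With Pf = af - be + cd, the bracketed sum is Pf(s + t) - Pf(s) - Pf(t). The factor -2 arises
    because each off-diagonal pair counts twice and t_ji = -t_ij. *)
Lemma star_formE s t : star_form s t = - 2%:R *
  let s := vsval s in let t := vsval t in
  (s 2 3 * t 0 1 - s 1 3 * t 0 2 + s 1 2 * t 0 3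
   + s 0 3 * t 1 2 - s 0 2 * t 1 3 + s 0 1 * t 2 3).
Proof.
rewrite /star_form /mxtrace sum_ord4 ![(vsval (star s) *m _) _ _]mxE !sum_ord4 /=.
by rewrite !(alt4E (star_mx_alt _)) !star_mxE !(alt4E (valP t)); ring.
Qed.

Lemma star_form_sym : symmetric_bilinear (@star_form F).
Proof. by move=> s t; rewrite !star_formE /=; ring. Qed.

Lemma star_form_bilinear : bilinear_for *%R *%R (@star_form F).
Proof.
have lin s k t t' : star_form s (k *: t + t') = k * star_form s t + star_form s t'.
  exact: (trace_fun_linear (star s) k t t').
by split=> [t|t] k u v /=; rewrite ?lin // !(star_form_sym _ t) lin.
Qed.

Lemma star_form_invariant : lie_invariant (@star_form F).
Proof.
by move=> x s t; rewrite /star_form star_act; apply: mxtrace_coact.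
Qed.

(** The left kernel is trivial because the trace pairing is nondegenerate and the star injective;
    symmetry handles the right kernel. *)
Lemma star_form_nondeg : 2%N \notin [pchar F] -> nondegenerate_form (@star_form F).
Proof.
move=> hF.
have nondeg s : (forall t, star_form s t = 0) -> s = 0.
  move=> s0; apply: (bij_inj (star_bij F)); apply: val_inj; rewrite linear0 /=.
  apply: (alt_trace_nondeg hF (star_mx_alt _)) => u u_alt.
  exact: (s0 (Subvs u_alt)).
split=> [|t t0]; first exact: nondeg.
by apply: nondeg => s; rewrite star_form_sym.
Qed.

Lemma trace_pairing_linear n : linear (@trace_pairing F n).
Proof.
move=> k t t'; apply/lfunP=> u; rewrite add_lfunE scale_lfunE !trace_pairingE.
by rewrite mulmxDl -scalemxAl linearP.
Qed.

Lemma trace_pairing_act n (x : sl F n) (t : altC F n) :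
  trace_pairing (x \act t) = x \act trace_pairing t.
Proof.
apply/lfunP=> u; rewrite [RHS]dual_actE linearN /= !trace_pairingE.
apply/eqP; rewrite -addr_eq0; apply/eqP.
exact: mxtrace_coact.
Qed.

Definition star_dual s : lie_dual (altT F 4) := trace_pairing (star s).

Lemma star_dual_linear : linear star_dual.
Proof. by move=> k s t; rewrite /star_dual linearP trace_pairing_linear. Qed.
HB.instance Definition _ :=
  GRing.isLinear.Build F (altT F 4) (lie_dual (altT F 4)) *:%R star_dual star_dual_linear.

Lemma star_dual_bij : 2%N \notin [pchar F] -> bijective star_dual.
Proof.
move=> hF; apply: linear_inj_bij => [s t st|].
  apply/subr0_eq; apply: (star_form_nondeg hF).1 => u.
  have /lfunP/(_ u) : star_dual (s - t) = 0 by rewrite linearB /= st subrr.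
  by rewrite zero_lfunE trace_pairingE.
(* A space and its dual have equal dimension, so injectivity suffices. *)
by rewrite !dimvf /dim /= muln1.
Qed.

End Form.

(** * Skew-symmetric matrices from an orthogonal frame *)

Section OrthogonalRepresentation.
Variables (F : fieldType) (L : lieAlgType F) (V : lieModType L) (n : nat).
Variables (coord : {linear V -> 'rV[F]_n}) (vect : {linear 'rV[F]_n -> V}).
Hypothesis vectK : cancel vect coord.
Hypothesis coordK : cancel coord vect.
Hypothesis coord_invariant : forall (x : L) u v,
  coord (x \act u) *m (coord v)^T + coord u *m (coord (x \act v))^T = 0.

Definition act_mx (x : L) : 'M[F]_n := lin1_mx (coord \o lie_act x \o vect).

Lemma mul_act_mx x v : v *m act_mx x = coord (x \act vect v).
Proof. exact: mul_rV_lin1. Qed.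

(** For A = [act_mx x], invariance on the basis vectors e_j and e_i reads (A + A^T)_ji = 0. *)
Lemma act_mx_so x : - act_mx x \in so_space F n.
Proof.
rewrite rpredN mem_so -addr_eq0; apply/eqP/matrixP=> i j.
have := coord_invariant x (vect (delta_mx 0 j)) (vect (delta_mx 0 i)).
rewrite -!mul_act_mx !vectK => /matrixP/(_ 0 0).
rewrite trmx_mul trmx_delta mulmxA -mulmxDl -mulmxDr.
by rewrite -rowE -colE !mxE addrC.
Qed.

(* Row vectors make [act_mx] an antimorphism; the sign compensates, as
   transposition would. *)
Definition so_rep x : so F n := Subvs (act_mx_so x).

Lemma so_rep_linear : linear so_rep.
Proof.
move=> k x y; apply: val_inj => /=; apply/row_matrixP=> i.
rewrite !rowE mulmxN mulmxDr -scalemxAr !mulmxN !mul_act_mx.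
have /= -> := (@lie_act_bilinear F L V).1 (vect (delta_mx 0 i)) k x y.
by rewrite linearP scalerN opprD.
Qed.

HB.instance Definition _ :=
  GRing.isLinear.Build F L (so F n) *:%R so_rep so_rep_linear.

Lemma so_rep_bracket : {morph so_rep : x y / \[ x, y ]}.
Proof.
move=> x y; apply: val_inj => /=; apply/row_matrixP=> i.
rewrite /commmx !rowE mulmxN mulmxBr !mulNmx !mulmxN !opprK !mulmxA !mul_act_mx.
by rewrite !coordK lie_act_bracket linearB opprB.
Qed.

Lemma so_rep_ker x : so_rep x = 0 -> forall v : V, x \act v = 0.
Proof.
move=> /(congr1 val) /= /eqP; rewrite oppr_eq0 => /eqP x0 v.
by rewrite -[v]coordK -[LHS]coordK -mul_act_mx x0 mulmx0 linear0.
Qed.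

End OrthogonalRepresentation.

(** * An orthogonal frame of T, and the isomorphism of sl(4) with so(6) *)

Section Frame.
Variables (F : fieldType) (im : F).
Hypothesis im2 : im ^+ 2 = -1.
Hypothesis hF : 2%N \notin [pchar F].

Let two_neq0 : 2%:R != 0 :> F.
Proof. by apply: contra hF => h2; rewrite inE /= h2. Qed.

(** The squares of these coordinates add up to 4 (af - be + cd): 4af = (a + f)^2 + (im (a - f))^2,
    -4be = (b - e)^2 + (im (b + e))^2, and 4cd is like 4af. *)
Definition frame_coord_mx (s : 'M[F]_4) : 'rV[F]_6 :=
  \row_j [:: s 0 1 + s 2 3; im * (s 0 1 - s 2 3);
            s 0 2 - s 1 3; im * (s 0 2 + s 1 3);
            s 0 3 + s 1 2; im * (s 0 3 - s 1 2)]`_j.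
Definition frame_coord (s : altT F 4) := frame_coord_mx (vsval s).

(* [star_mx] reads only the strictly upper entries and is alternating whatever
   its argument, hence it serves as a constructor here. *)
Definition frame_vect (v : 'rV[F]_6) : altT F 4 :=
  Subvs (star_mx_alt (2%:R^-1 *: mx_of_rows 4
    [:: [:: 0; v 0 0 + im * v 0 1; v 0 2 + im * v 0 3;   v 0 4 + im * v 0 5];
        [:: 0; 0;                  v 0 4 - im * v 0 5; - (v 0 2 - im * v 0 3)];
        [:: 0; 0;                  0;                    v 0 0 - im * v 0 1]])).

Lemma frame_coord_linear : linear frame_coord.
Proof.
suff lin : linear frame_coord_mx by move=> k s t; exact: lin.
move=> k s t; apply/rowP; rewrite /frame_coord_mx.
by case=> [[|[|[|[|[|[|//]]]]]] ?]; rewrite !mxE /=; ring.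
Qed.
HB.instance Definition _ :=
  GRing.isLinear.Build F (altT F 4) 'rV[F]_6 *:%R frame_coord frame_coord_linear.

Lemma frame_vectK : cancel frame_vect frame_coord.
Proof.
move=> v; apply/rowP=> j; rewrite [LHS]mxE /= !star_mxE !mxE /=.
(* Case analysis leaves ordinals with different bound proofs; [vE] restores the numerals, so that
   [field] sees equal atoms. *)
have vE (i k : 'I_6) : i = k :> nat -> v 0 i = v 0 k by move/val_inj->.
case: j => [[|[|[|[|[|[|//]]]]]] ?] /=;
  [rewrite [RHS](vE _ 0)|rewrite [RHS](vE _ 1)|rewrite [RHS](vE _ 2)
  |rewrite [RHS](vE _ 3)|rewrite [RHS](vE _ 4)|rewrite [RHS](vE _ 5)] => //;
  field: im2; exact: two_neq0.
Qed.

Lemma frame_coordK : cancel frame_coord frame_vect.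
Proof.
move=> s; apply: val_inj; apply: alt4_eqP; rewrite ?(valP s) ?star_mx_alt //;
  by split; rewrite star_mxE !mxE /=; field: im2; exact: two_neq0.
Qed.

Lemma frame_vect_linear : linear frame_vect.
Proof. exact: can2_linear frame_coordK frame_vectK. Qed.
HB.instance Definition _ :=
  GRing.isLinear.Build F 'rV[F]_6 (altT F 4) *:%R frame_vect frame_vect_linear.

(** Polarization of the six-square identity: the dot product becomes -g, which inherits the
    invariance of g. *)
Lemma frame_coord_form s t :
  frame_coord s *m (frame_coord t)^T = (- star_form s t)%:M.
Proof.
apply/matrixP=> i j; rewrite !ord1 star_formE !mxE /= !big_ord_recl big_ord0 !mxE /= mulr1n.
ring: im2.
Qed.

Lemma frame_coord_invariant (x : sl F 4) s t :
  frame_coord (x \act s) *m (frame_coord t)^T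
  + frame_coord s *m (frame_coord (x \act t))^T = 0.
Proof.
by rewrite !frame_coord_form -raddfD -opprD star_form_invariant oppr0 raddf0.
Qed.

Lemma sl4_so6_isomorphic : lie_isomorphic (sl F 4) (so F 6).
Proof.
pose f := so_rep frame_vectK frame_coord_invariant.
exists f; split; [exact: so_rep_linear | | by apply: so_rep_bracket; exact: frame_coordK].
apply: linear_inj_bij => [x y xy|].
  apply/subr0_eq/val_inj; apply: alt_act_faithful hF _ _ => // s s_alt.
  have fxy0 : f (x - y) = 0.
    by apply/eqP; rewrite /f linearB subr_eq0; apply/eqP.
  have xys0 : (x - y) \act (Subvs s_alt : altT F 4) = 0.
    by apply: so_rep_ker fxy0 _; exact: frame_coordK.
  exact: (congr1 (fun u : altT F 4 => vsval u) xys0).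
(* The two bounds meet at C(6, 2) = 15 = 4^2 - 1. *)
rewrite !dimvf; apply: leq_trans (dim_so_le 6 hF) (dim_sl_ge F 4).
Qed.

End Frame.

Theorem theorem5p3 (F : fieldType) (hF : 2%N \notin [pchar F]) :
  [/\ lie_module_isomorphism (@star F : altT F 4 -> altC F 4),
      lie_module_isomorphism
        (fun s : altT F 4 => trace_pairing (star s) : lie_dual (altT F 4)),
      [/\ bilinear_for *%R *%R (@star_form F),
          nondegenerate_form (@star_form F),
          lie_invariant (@star_form F),
          symmetric_bilinear (@star_form F)
        & forall s t : altT F 4,
            star_form s t
            = (trace_pairing (star s) : 'Hom(altT F 4, F^o)) t]
    & (forall x : F, exists y : F, x = y ^+ 2) ->
        lie_isomorphic (sl F 4) (so F 6)].
Proof.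
split.
- by split; [exact: star_linear | exact: star_bij | exact: star_act].
- split; [exact: star_dual_linear | exact: star_dual_bij | move=> x s].
  by rewrite star_act trace_pairing_act.
- split; [exact: star_form_bilinear | exact: star_form_nondeg
    | exact: star_form_invariant | exact: star_form_sym | move=> s t].
  by rewrite trace_pairingE.
(* The square root of -1 is the [im] on which the frame is built. *)
move=> /(_ (-1))[im im2]; exact: (sl4_so6_isomorphic (esym im2)).
Qed.
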